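(* Let $\phi_1,\dots,\phi_N:X\to\mathbb R$ be continuous and assume: (A) for all $i\neq j$ in $I$ and all $\alpha,\beta\in\mathbb R$: $\mu\left(\{x\in X:\ \alpha\psi_i(x)-\beta\psi_j(x)+\phi_i(x)-\phi_j(x)=0\}\right)=0$; (B) for all $i\in I$ and all $\alpha\in\mathbb R$: $\mu\left(\{x\in X:\ \phi_i(x)=\alpha\psi_i(x)\}\right)=0$; (C) $\psi_i>0$ on $X$ for every $i\in I$, and for all $i\neq j$ in $I$ and all $\alpha,\beta\in\mathbb R$ with $\alpha^2+\beta^2>0$: $\mu\left(\{x\in X:\ \alpha\psi_i(x)+\beta\psi_j(x)=0\}\right)=0$. Let $K\subset\mathbb R^N$ be a closed convex set such that $\underline{\mathcal P}^{\psi,w}_K\neq\emptyset$. Then there exists a unique subpartition $\vec\mu\in\underline{\mathcal P}^{\psi,w}_K$ which maximizes the total profit $\sum_{i=1}^N\int_X\phi_i\,d\mu_i$ over $\underline{\mathcal P}^{\psi,w}_K$, and this subpartition is a strong one.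
   Context: $X$ is a compact Polish space with Borel $\sigma$-algebra $\mathcal B$, $\mu$ is a non-atomic Borel probability measure on $X$, $I=\{1,\dots,N\}$, and $\psi_1,\dots,\psi_N:X\to\mathbb R$ are continuous. For $\vec m\in\mathbb R^N$, $\underline{\mathcal P}^{\psi,w}_{\vec m}$ (weak subpartitions) is the set of $N$-tuples $\vec\mu=(\mu_1,\dots,\mu_N)$ of non-negative Borel measures on $X$ with $\sum_i\mu_i\le\mu$ and $\int_X\psi_i\,d\mu_i=m_i$ for all $i\in I$. For $K\subset\mathbb R^N$, $\underline{\mathcal P}^{\psi,w}_K=\bigcup_{\vec m\in K}\underline{\mathcal P}^{\psi,w}_{\vec m}$. A weak subpartition $\vec\mu\in\underline{\mathcal P}^{\psi,w}_{\vec m}$ is called strong if there are sets $X_1,\dots,X_N\in\mathcal B$ with $\mu(X_i\cap X_j)=0$ for $i\ne j$, $\int_{X_i}\psi_i\,d\mu=m_i$ for all $i$, and $\mu_i=\mu\lfloor X_i$ (restriction of $\mu$ to $X_i$) for all $i$. Strong subpartitions are identified in this way with weak ones (hence up to $\mu$-null sets). *)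

(* Defs.v *)
From mathcomp Require Import all_boot all_order all_algebra.
From mathcomp Require Import all_classical all_reals all_analysis.

Set Implicit Arguments.
Unset Strict Implicit.
Unset Printing Implicit Defensive.

Import Order.TTheory GRing.Theory Num.Theory.
Import numFieldNormedType.Exports.

Local Open Scope classical_set_scope.
Local Open Scope ring_scope.

Section polish.
Context {R : realType} {X : topologicalType}.
Implicit Type d : X -> X -> R.

Definition is_metric d :=
  [/\ forall x y, 0 <= d x y,
      forall x y, d x y = 0 <-> x = y,
      forall x y, d x y = d y x &
      forall x y z, d x z <= d x y + d y z].

Definition metrizes d :=
  forall (x : X) (A : set X),
    nbhs x A <-> exists2 e : R, 0 < e & [set y | d x y < e] `<=` A.

Definition cauchy_seq d (u : nat -> X) :=
  forall e : R, 0 < e -> exists n0 : nat,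
    forall m n : nat, (n0 <= m)%N -> (n0 <= n)%N -> d (u m) (u n) < e.

Definition complete_metric d :=
  forall u : nat -> X, cauchy_seq d u -> exists l : X, u @ \oo --> l.

End polish.

Definition polish (R : realType) (X : topologicalType) :=
  (exists d : X -> X -> R, [/\ is_metric d, metrizes d & complete_metric d]) /\
  (exists2 D : set X, countable D & dense D).

(* [X] equipped with its Borel sigma-algebra. The library asks for a pointed
   type here; a space carrying a probability measure is inhabited anyway. *)
Notation borel X := (g_sigma_algebraType (@open X)).

Definition non_atomic (d : measure_display) (T : measurableType d)
    (R : realType) (mu : {measure set T -> \bar R}) :=
  forall A : set T, measurable A -> (0 < mu A)%E ->
    exists B : set T, [/\ measurable B, B `<=` A, (0 < mu B)%E & (mu B < mu A)%E].

Section subpartitions.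
Context {R : realType} {X : ptopologicalType} {N : nat}.
Variable mu : {measure set (borel X) -> \bar R}.
Variables psi phi : 'I_N -> X -> R.
Implicit Type nu : 'I_N -> {measure set (borel X) -> \bar R}.

Definition weak_subpartitions (m : 'rV[R]_N)
    : set ('I_N -> {measure set (borel X) -> \bar R}) :=
  [set nu | (forall A, measurable A -> (\sum_(i < N) nu i A <= mu A)%E) /\
            (forall i, \int[nu i]_x (psi i x)%:E = (m 0 i)%:E)%E].

Definition weak_subpartitions_in (K : set 'rV[R]_N)
    : set ('I_N -> {measure set (borel X) -> \bar R}) :=
  \bigcup_(m in K) weak_subpartitions m.

Definition strong_subpartitions (m : 'rV[R]_N)
    : set ('I_N -> {measure set (borel X) -> \bar R}) :=
  [set nu | weak_subpartitions m nu /\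
    exists Y : 'I_N -> set (borel X),
      [/\ forall i, measurable (Y i),
          forall i j, i != j -> mu (Y i `&` Y j) = 0%E,
          forall i, (\int[mu]_(x in Y i) (psi i x)%:E = (m 0 i)%:E)%E &
          forall i A, measurable A -> nu i A = mu (A `&` Y i)]].

(* Library measures are functions on all subsets and are unconstrained on the
   non-measurable ones, so Leibniz equality would be too strong here. *)
Definition eq_subpartition nu nu' :=
  forall i A, measurable A -> nu i A = nu' i A.

Definition profit nu : \bar R :=
  (\sum_(i < N) \int[nu i]_x (phi i x)%:E)%E.

Definition maximizes_profit (K : set 'rV[R]_N) nu :=
  weak_subpartitions_in K nu /\
  forall nu', weak_subpartitions_in K nu' -> (profit nu' <= profit nu)%E.

End subpartitions.

(* Main.v *)
Require Import Defs.
From mathcomp Require Import all_boot all_order all_algebra.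
From mathcomp Require Import all_classical all_reals all_analysis.
From mathcomp Require Import measurable_realfun.
From mathcomp Require Import ring lra.

Set Implicit Arguments.
Unset Strict Implicit.
Unset Printing Implicit Defensive.

Import Order.TTheory GRing.Theory Num.Theory.
Import numFieldNormedType.Exports.

Local Open Scope classical_set_scope.
Local Open Scope ring_scope.

(** By the Radon-Nikodym theorem a subpartition is a family of densities
    p_i >= 0 with sum at most 1. Adding the density p_0 of the unassigned part
    of mu, with psi_0 = phi_0 = 0, makes it a fractional partition: a
    measurable map into the simplex. Conditions (A) and (B) then become one
    condition on pairs of distinct indices, [generic_pairs].

    Strongness ([gain_optimal_disjoint]). Let p have maximal gain among the
    fractional partitions with the same moments, and let i <> j. Moving the
    signed mass h = c w p_i p_j from j to i keeps p in the simplex as soon as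
    |c w| <= 1. Take for w the residual of the orthogonal projection of
    phi_i - phi_j onto the span of psi_i and psi_j in L^2(p_i p_j mu): the
    moments do not move, and the gain increases by c times the integral of
    w^2 p_i p_j. Optimality makes w^2 p_i p_j vanish a.e., and w itself
    vanishes only on a null set, by genericity; hence p_i p_j = 0 a.e. The
    p_i being of sum 1, each of them is a.e. an indicator.

    Uniqueness ([maximal_uniq]). Since K is convex, the midpoint of two
    maximizers is a maximizer; all three take values in {0, 1} a.e., which
    forces them to agree.

    Existence ([exists_maximal]). Among nearly optimal partitions one picks
    partitions of nearly minimal L^2 norm; this replaces weak compactness. By
    the parallelogram identity they form a Cauchy sequence in L^2, as fast as
    desired, hence converge a.e.; dominated convergence carries moments and
    gain to the limit, and K is closed.

    The maximizing subpartition is the restriction of mu to the sets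
    {p_i = 1}. *)

(** * Bounded measurable functions and their means *)

Section bounded_measurable.
Context d (T : measurableType d) (R : realType) (mu : probability T R).
Implicit Types u v w : T -> R.

Definition bounded_measurable u :=
  measurable_fun setT u /\ exists M : R, forall x, `|u x| <= M.

Lemma bounded_measurable_cst (c : R) : bounded_measurable (fun=> c).
Proof. by split=> //; exists `|c|. Qed.

Lemma bounded_measurableD u v : bounded_measurable u -> bounded_measurable v ->
  bounded_measurable (fun x => u x + v x).
Proof.
move=> [mu_ [M uM]] [mv [M' vM]]; split; first exact: measurable_funD.
by exists (M + M') => x; rewrite (le_trans (ler_normD _ _))// lerD.
Qed.

Lemma bounded_measurableM u v : bounded_measurable u -> bounded_measurable v ->
  bounded_measurable (fun x => u x * v x).
Proof.
move=> [mu_ [M uM]] [mv [M' vM]]; split; first exact: measurable_funM.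
by exists (M * M') => x; rewrite normrM ler_pM.
Qed.

Lemma bounded_measurableZ (c : R) u : bounded_measurable u ->
  bounded_measurable (fun x => c * u x).
Proof. exact: bounded_measurableM (bounded_measurable_cst c). Qed.

Lemma bounded_measurableB u v : bounded_measurable u -> bounded_measurable v ->
  bounded_measurable (fun x => u x - v x).
Proof.
move=> bu /(bounded_measurableZ (-1)) bv.
have -> : (fun x => u x - v x) = (fun x => u x + -1 * v x).
  by apply/funext => x; rewrite mulN1r.
exact: bounded_measurableD.
Qed.

Lemma bounded_measurable_sum (I : Type) (r : seq I) (P : pred I)
    (u : I -> T -> R) : (forall i, bounded_measurable (u i)) ->
  bounded_measurable (fun x => \sum_(i <- r | P i) u i x).
Proof.
move=> bu; elim: r => [|i r ih].
  have -> : (fun x => \sum_(i <- [::] | P i) u i x) = fun=> 0.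
    by apply/funext => x; rewrite big_nil.
  exact: bounded_measurable_cst.
have -> : (fun x => \sum_(i <- i :: r | P i) u i x) =
   (fun x => (if P i then u i x else 0) + \sum_(i <- r | P i) u i x).
  by apply/funext => x; rewrite big_cons; case: ifP; rewrite ?add0r.
apply: bounded_measurableD => //; case: (P i) => //.
exact: bounded_measurable_cst.
Qed.

Lemma bounded_measurable_integrable u : bounded_measurable u ->
  mu.-integrable setT (EFin \o u).
Proof.
move=> [mu_ [M uM]]; apply: measurable_bounded_integrable => //.
  exact: fin_num_fun_lty (fin_num_measure mu).
by exists M; split; [exact: num_real|move=> N MN x _; exact: le_trans (ltW MN)].
Qed.

Local Notation E := (Rintegral mu setT).

Lemma mean_cst (c : R) : E (fun=> c) = c.
Proof.
rewrite Rintegral_cst// -[RHS]mulr1; congr (_ * _).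
rewrite -[1]/(fine 1%E); congr fine; exact: probability_setT.
Qed.

Lemma meanD u v : bounded_measurable u -> bounded_measurable v ->
  E (fun x => u x + v x) = E u + E v.
Proof.
by move=> bu bv; apply: RintegralD => //;
  exact: bounded_measurable_integrable.
Qed.

Lemma meanB u v : bounded_measurable u -> bounded_measurable v ->
  E (fun x => u x - v x) = E u - E v.
Proof.
by move=> bu bv; apply: RintegralB => //;
  exact: bounded_measurable_integrable.
Qed.

Lemma meanZ (c : R) u : bounded_measurable u -> E (fun x => c * u x) = c * E u.
Proof.
by move=> bu; apply: RintegralZl => //;
  exact: bounded_measurable_integrable.
Qed.

Lemma mean_le u v : bounded_measurable u -> bounded_measurable v ->
  (forall x, u x <= v x) -> E u <= E v.
Proof.
by move=> bu bv uv; apply: le_Rintegral => //;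
  exact: bounded_measurable_integrable.
Qed.

Lemma mean_EFin u : bounded_measurable u ->
  (\int[mu]_x (u x)%:E = (E u)%:E)%E.
Proof.
move=> bu; rewrite /Rintegral fineK//.
by apply: integrable_fin_num => //; exact: bounded_measurable_integrable.
Qed.

Lemma mean_le0_ae u : bounded_measurable u -> (forall x, 0 <= u x) ->
  E u <= 0 -> {ae mu, forall x, u x = 0}.
Proof.
move=> bu u0 Eu.
have /(ae_eq_integral_abs mu measurableT) : measurable_fun setT (EFin \o u).
  by apply/measurable_EFinP; case: bu.
case=> + _; case.
  under eq_integral do rewrite /= ger0_norm//.
  rewrite mean_EFin//; congr EFin; apply/le_anti.
  by rewrite Eu Rintegral_ge0.
move=> N [mN N0 sN]; exists N; split=> //; apply: subset_trans sN => x /=.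
by apply: contra_not => /(_ I)[].
Qed.

(** Gram-Schmidt for the positive semidefinite form E (u v rho): when
    E (u^2 rho) = 0, Cauchy-Schwarz makes u already orthogonal to g, so the
    degenerate case needs no correction. *)
Lemma orthogonal_residual1 rho u g : bounded_measurable rho ->
  (forall x, 0 <= rho x) -> bounded_measurable u -> bounded_measurable g ->
  exists a : R, E (fun x => (a * u x + g x) * u x * rho x) = 0.
Proof.
move=> brho rho0 bu bg.
have bf v w : bounded_measurable v -> bounded_measurable w ->
    bounded_measurable (fun x => v x * w x * rho x).
  by move=> bv bw; do 2 apply: bounded_measurableM => //.
pose F v w := E (fun x => v x * w x * rho x).
have Eexp a : E (fun x => (a * u x + g x) * u x * rho x) = a * F u u + F g u.
  rewrite -meanZ; last exact: bf.
  rewrite -meanD; [|exact/bounded_measurableZ/bf|exact: bf].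
  by congr (E _); apply/funext => x; ring.
have [Fuu|Fuu] := eqVneq (F u u) 0; last first.
  by exists (- F g u / F u u); rewrite Eexp divfK// addNr.
exists 0; rewrite Eexp mul0r add0r; apply/eqP/negPn/negP => Fgu.
have Fquad t : 0 <= t * t * F g g + 2 * t * F g u.
  have <- : E (fun x => (t * g x + u x) * (t * g x + u x) * rho x) =
    t * t * F g g + 2 * t * F g u.
    rewrite -[RHS]addr0 -Fuu /F -!meanZ; try exact: bf.
    rewrite -!meanD; try by repeat first [
      apply: bounded_measurableD | apply: bounded_measurableZ | exact: bf].
    by congr (E _); apply/funext => x; ring.
  by apply: Rintegral_ge0 => x _; rewrite mulr_ge0// -expr2 sqr_ge0.
have Fgg : 0 <= F g g.
  by apply: Rintegral_ge0 => x _; rewrite mulr_ge0// -expr2 sqr_ge0.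
have Fgg1 : 0 < F g g + 1 by rewrite ltr_wpDl.
(* t = - F g u / F g g is the minimizer; adding 1 avoids a zero divisor *)
have := Fquad (- F g u / (F g g + 1)).
have -> : - F g u / (F g g + 1) * (- F g u / (F g g + 1)) * F g g +
   2 * (- F g u / (F g g + 1)) * F g u =
   - (F g u ^+ 2 / (F g g + 1) ^+ 2 * (F g g + 2)).
  by field; rewrite gt_eqF.
rewrite oppr_ge0 leNgt => /negP; apply.
apply: mulr_gt0; last by rewrite ltr_wpDl.
by apply: divr_gt0; [rewrite exprn_even_gt0|exact: exprn_gt0].
Qed.

(** Two steps of Gram-Schmidt: v is first made orthogonal to u, so that
    correcting g along the new v does not spoil its orthogonality to u. *)
Lemma orthogonal_residual2 rho u v g : bounded_measurable rho ->
  (forall x, 0 <= rho x) -> bounded_measurable u -> bounded_measurable v ->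
  bounded_measurable g ->
  exists a b : R, E (fun x => (a * u x + b * v x + g x) * u x * rho x) = 0 /\
                  E (fun x => (a * u x + b * v x + g x) * v x * rho x) = 0.
Proof.
move=> brho rho0 bu bv bg.
have bl a b y z : bounded_measurable y -> bounded_measurable z ->
   bounded_measurable (fun x => (a * u x + y x) * z x * rho x).
  move=> by_ bz; do 2 apply: bounded_measurableM => //.
  by apply: bounded_measurableD => //; exact: bounded_measurableZ.
have [c Ec] := orthogonal_residual1 brho rho0 bu bv.
have [a Ea] := orthogonal_residual1 brho rho0 bu bg.
pose v' x := c * u x + v x.
have bv' : bounded_measurable v'.
  by apply: bounded_measurableD => //; exact: bounded_measurableZ.
pose g' x := a * u x + g x.
have bg' : bounded_measurable g'.
  by apply: bounded_measurableD => //; exact: bounded_measurableZ.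
have [b Eb] := orthogonal_residual1 brho rho0 bv' bg'.
have b3 y z : bounded_measurable y -> bounded_measurable z ->
   bounded_measurable (fun x => y x * z x * rho x).
  by move=> ? ?; do 2 apply: bounded_measurableM => //.
have bw : bounded_measurable (fun x => b * v' x + g' x).
  by apply: bounded_measurableD => //; exact: bounded_measurableZ.
exists (a + b * c), b.
have -> : (fun x => ((a + b * c) * u x + b * v x + g x) * u x * rho x) =
    (fun x => b * (v' x * u x * rho x) + g' x * u x * rho x).
  by apply/funext => x; rewrite /v' /g'; ring.
have Eu : E (fun x => b * (v' x * u x * rho x) + g' x * u x * rho x) = 0.
  rewrite meanD; [|exact/bounded_measurableZ/b3|exact: b3].
  by rewrite meanZ ?Ec ?Ea ?mulr0 ?addr0//; exact: b3.
split=> //.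
have -> : (fun x => ((a + b * c) * u x + b * v x + g x) * v x * rho x) =
    (fun x => (b * v' x + g' x) * v' x * rho x
       - c * (b * (v' x * u x * rho x) + g' x * u x * rho x)).
  by apply/funext => x; rewrite /v' /g'; ring.
have bq : bounded_measurable
    (fun x => b * (v' x * u x * rho x) + g' x * u x * rho x).
  by apply: bounded_measurableD; [exact/bounded_measurableZ/b3|exact: b3].
rewrite meanB ?meanZ ?Eb ?Eu ?mulr0 ?subr0//.
- exact: b3.
- exact: bounded_measurableZ.
Qed.

End bounded_measurable.

(** * Fractional partitions *)

Section fractional_partitions.
Context d (T : measurableType d) (R : realType) (mu : probability T R).
Context (I : finType) (psi phi : I -> T -> R).
Hypothesis psi_bm : forall i, bounded_measurable (psi i).
Hypothesis phi_bm : forall i, bounded_measurable (phi i).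
Implicit Types p q : I -> T -> R.

Local Notation E := (Rintegral mu setT).

Definition fractional_partition p :=
  [/\ forall i, measurable_fun setT (p i),
      forall i x, 0 <= p i x &
      forall x, \sum_i p i x = 1].

Definition moment p i := E (fun x => psi i x * p i x).

Definition gain p := \sum_i E (fun x => phi i x * p i x).

Definition midpoint p q i x := 2^-1 * (p i x + q i x).

Lemma fractional_partition_le1 p : fractional_partition p ->
  forall i x, p i x <= 1.
Proof.
move=> [_ p0 p1] i x; rewrite -(p1 x) (bigD1 i)//= lerDl.
by apply: sumr_ge0 => j _.
Qed.

Lemma fractional_partition_bm p : fractional_partition p ->
  forall i, bounded_measurable (p i).
Proof.
move=> pp i; split; first by case: pp.
exists 1 => x; rewrite ger0_norm ?fractional_partition_le1//.
by case: pp.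
Qed.

Lemma fractional_partition_midpoint p q : fractional_partition p ->
  fractional_partition q -> fractional_partition (midpoint p q).
Proof.
move=> pp qq; split.
- move=> i.
  have /fractional_partition_bm/(_ i) bp := pp.
  have /fractional_partition_bm/(_ i) bq := qq.
  by have [] := bounded_measurableZ 2^-1 (bounded_measurableD bp bq).
- by case: pp qq => _ p0 _ [_ q0 _] i x; rewrite mulr_ge0 ?addr_ge0 ?invr_ge0.
- case: pp qq => _ _ p1 [_ _ q1] x.
  by rewrite -mulr_sumr big_split/= p1 q1 mulVf.
Qed.

Lemma mean_midpoint (u : I -> T -> R) p q i :
  (forall i, bounded_measurable (u i)) ->
  fractional_partition p -> fractional_partition q ->
  E (fun x => u i x * midpoint p q i x) =
  2^-1 * (E (fun x => u i x * p i x) + E (fun x => u i x * q i x)).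
Proof.
move=> bu pp qq.
have bp : bounded_measurable (fun x => u i x * p i x).
  by apply: bounded_measurableM => //; exact: fractional_partition_bm.
have bq : bounded_measurable (fun x => u i x * q i x).
  by apply: bounded_measurableM => //; exact: fractional_partition_bm.
rewrite -meanD// -meanZ//; last exact: bounded_measurableD.
by congr (E _); apply/funext => x; rewrite /midpoint; ring.
Qed.

Lemma moment_midpoint p q : fractional_partition p -> fractional_partition q ->
  forall i, moment (midpoint p q) i = 2^-1 * (moment p i + moment q i).
Proof. by move=> pp qq i; exact: mean_midpoint. Qed.

Lemma gain_midpoint p q : fractional_partition p -> fractional_partition q ->
  gain (midpoint p q) = 2^-1 * (gain p + gain q).
Proof.
move=> pp qq; rewrite /gain -big_split mulr_sumr/=.
by apply: eq_bigr => i _; exact: mean_midpoint.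
Qed.

(** No combination of psi i and psi j agrees with phi i - phi j on a set of
    positive measure, which keeps projection residuals away from zero. *)
Definition generic_pairs := forall i j, i != j -> forall a b : R,
  mu [set x | a * psi i x - b * psi j x + phi i x - phi j x = 0] = 0%E.

(** Optimality at fixed moments is what the perturbation argument needs: it
    does not involve the set of admissible moments. *)
Definition gain_optimal p := forall q, fractional_partition q ->
  (forall i, moment q i = moment p i) -> gain q <= gain p.

(** The coefficients of a transfer of mass from j to i. *)
Lemma sum_transfer (i j : I) (c : I -> R) :
  \sum_k ((k == i)%:R - (k == j)%:R) * c k = c i - c j.
Proof.
have sumdelta l : \sum_k (k == l)%:R * c k = c l.
  rewrite (bigD1 l)//= eqxx mul1r big1 ?addr0// => k /negbTE->.
  by rewrite mul0r.
by under eq_bigr do rewrite mulrBl; rewrite sumrB !sumdelta.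
Qed.

(** Transferring h = w p_i p_j / M from j to i, where w is the residual of
    phi_i - phi_j for the weight p_i p_j, fixes the moments and adds to the
    gain the mean of w^2 p_i p_j / M, which must therefore vanish. The weight
    p_i p_j also bounds h by both p_i and p_j. *)
Lemma gain_optimal_disjoint p : generic_pairs -> fractional_partition p ->
  gain_optimal p ->
  forall i j, i != j -> {ae mu, forall x, p i x * p j x = 0}.
Proof.
move=> gen pp opt i j ij.
have bp := fractional_partition_bm pp.
have p0 k x : 0 <= p k x by case: pp.
have p1 := fractional_partition_le1 pp.
pose rho x := p i x * p j x.
have brho : bounded_measurable rho by exact: bounded_measurableM.
have rho0 x : 0 <= rho x by rewrite mulr_ge0.
have bg : bounded_measurable (fun x => phi i x - phi j x).
  exact: bounded_measurableB.
have [a [b [Ei Ej]]] :=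
  orthogonal_residual2 mu brho rho0 (psi_bm i) (psi_bm j) bg.
pose w x := a * psi i x + b * psi j x + (phi i x - phi j x).
have bw : bounded_measurable w.
  apply: bounded_measurableD => //.
  by apply: bounded_measurableD; exact: bounded_measurableZ.
have [M M0 wM] : exists2 M : R, 0 < M & forall x, `|w x| <= M.
  have [_ [M wM]] := bw; exists (`|M| + 1); first by rewrite ltr_wpDl.
  by move=> x; rewrite (le_trans (wM x))// (le_trans (ler_norm _))// lerDl.
pose h x := M^-1 * (w x * rho x).
have bh : bounded_measurable h.
  exact/bounded_measurableZ/bounded_measurableM.
have hrho x : `|h x| <= rho x.
  rewrite /h 2!normrM (ger0_norm (rho0 x)) gtr0_norm ?invr_gt0// mulrA.
  by rewrite ler_piMl// ler_pdivrMl// mulr1.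
have sgn k : k != i -> k != j -> (k == i)%:R - (k == j)%:R = 0 :> R.
  by move=> /negbTE-> /negbTE->; rewrite subrr.
pose q k x := p k x + ((k == i)%:R - (k == j)%:R) * h x.
have ji : (j == i) = false by rewrite eq_sym (negbTE ij).
have rhoi x : rho x <= p i x by rewrite /rho ler_piMr.
have rhoj x : rho x <= p j x by rewrite /rho ler_piMl.
have qq : fractional_partition q.
  split=> [k|k x|x].
  - by have [] := bounded_measurableD (bp k)
      (bounded_measurableZ ((k == i)%:R - (k == j)%:R) bh).
  - have := hrho x; rewrite ler_norml => /andP[h1 h2].
    rewrite /q; have [->|ki] := eqVneq k i.
      rewrite (negbTE ij) subr0 mul1r; have := rhoi x; lra.
    have [->|kj] := eqVneq k j; first by have := rhoj x; rewrite sub0r mulN1r; lra.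
    by rewrite subrr mul0r addr0.
  - rewrite big_split /= (sum_transfer i j (fun=> h x)) subrr addr0.
    by case: pp.
have Eq (u : I -> T -> R) k : (forall k, bounded_measurable (u k)) ->
  E (fun x => u k x * q k x) = E (fun x => u k x * p k x) +
     ((k == i)%:R - (k == j)%:R) * E (fun x => u k x * h x).
  move=> bu; rewrite -meanZ; last exact: bounded_measurableM.
  rewrite -meanD; [|exact: bounded_measurableM|exact/bounded_measurableZ/bounded_measurableM].
  by congr (E _); apply/funext => x; rewrite /q; ring.
have Eh u : bounded_measurable u ->
    E (fun x => u x * h x) = M^-1 * E (fun x => w x * u x * rho x).
  move=> bu; rewrite -meanZ; last by do 2 apply: bounded_measurableM => //.
  by congr (E _); apply/funext => x; rewrite /h; ring.
have qm k : moment q k = moment p k.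
  rewrite /moment Eq//.
  have [->|ki] := eqVneq k i; first by rewrite Eh// Ei !mulr0 addr0.
  have [->|kj] := eqVneq k j; first by rewrite Eh// Ej !mulr0 addr0.
  by rewrite subrr mul0r addr0.
have := opt q qq qm.
have -> : gain q = gain p + E (fun x => (phi i x - phi j x) * h x).
  rewrite /gain; under eq_bigr do rewrite Eq//.
  rewrite big_split/= sum_transfer -meanB; try exact: bounded_measurableM.
  by congr (_ + E _); apply/funext => x; ring.
rewrite gerDl Eh// pmulr_rle0 ?invr_gt0//.
have -> : E (fun x => w x * (phi i x - phi j x) * rho x) =
  E (fun x => w x * w x * rho x).
  have b3 u v : bounded_measurable u -> bounded_measurable v ->
     bounded_measurable (fun x => u x * v x * rho x).
    by move=> ? ?; do 2 apply: bounded_measurableM => //.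
  transitivity (a * E (fun x => w x * psi i x * rho x) +
      b * E (fun x => w x * psi j x * rho x) +
      E (fun x => w x * (phi i x - phi j x) * rho x)).
    by rewrite Ei Ej !mulr0 !add0r.
  rewrite -!meanZ -?meanD; try by repeat first [apply: bounded_measurableD |
    apply: bounded_measurableZ | exact: b3].
  by congr (E _); apply/funext => x; rewrite {4}/w; ring.
move=> /mean_le0_ae; have {}/[swap]/[apply] : forall x, 0 <= w x * w x * rho x.
  by move=> x; rewrite mulr_ge0// -expr2 sqr_ge0.
have {}/[swap]/[apply] : bounded_measurable (fun x => w x * w x * rho x).
  by do 2 apply: bounded_measurableM => //.
(* {w = 0} is one of the null sets of genericity, with parameters a and -b *)
have w0 : {ae mu, forall x, w x <> 0}.
  exists [set x | w x = 0]; split.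
  - rewrite -[X in measurable X]setTI -[X in _ `&` X]/(w @^-1` [set 0]).
    by case: bw => mw _; apply: mw.
  - rewrite -(gen _ _ ij a (- b)); congr (mu _); apply/seteqP.
    by split=> x /=; rewrite /w => e; rewrite -[RHS]e; ring.
  - by move=> x /= /contrapT.
apply: filterS2 w0 => x w0 /eqP; rewrite !mulf_eq0 -orbA.
by case/or3P=> [/eqP//|/eqP//|/orP[]/eqP->]; rewrite ?mul0r ?mulr0.
Qed.

Lemma gain_optimal_idem p : generic_pairs -> fractional_partition p ->
  gain_optimal p -> {ae mu, forall x, forall i, p i x * p i x = p i x}.
Proof.
move=> gen pp opt; apply: filter_forall => i.
have disj : {ae mu, forall x, forall j, i != j -> p i x * p j x = 0}.
  apply: filter_forall => j; have [->|ij] := eqVneq i j.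
    by apply: aeW.
  by apply: filterS (gain_optimal_disjoint gen pp opt ij) => x ->.
apply: filterS disj => x disj.
have [_ _ p1] := pp.
rewrite -[RHS]mulr1 -(p1 x) mulr_sumr (bigD1 i)//= big1 ?addr0// => j.
by rewrite eq_sym => /disj.
Qed.

Section constrained.
Variable C : (I -> R) -> Prop.

Definition feasible p := fractional_partition p /\ C (moment p).

Definition maximal p := feasible p /\ forall q, feasible q -> gain q <= gain p.

Lemma maximal_gain_optimal p : maximal p -> gain_optimal p.
Proof.
move=> [[_ Cp] pmax] q qq qm; apply: pmax; split=> //.
by have -> : moment q = moment p by apply/funext.
Qed.

Lemma maximal_idem p : generic_pairs -> maximal p ->
  {ae mu, forall x, forall i, p i x * p i x = p i x}.
Proof.
move=> gen pmax; apply: gain_optimal_idem => //; first by case: pmax => -[].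
exact: maximal_gain_optimal.
Qed.

Hypothesis C_midpoint : forall a b, C a -> C b ->
  C (fun i => 2^-1 * (a i + b i)).

Lemma feasible_midpoint p q : feasible p -> feasible q ->
  feasible (midpoint p q).
Proof.
move=> [pp Cp] [qq Cq]; split; first exact: fractional_partition_midpoint.
by rewrite (funext (moment_midpoint pp qq)); exact: C_midpoint.
Qed.

(** The midpoint is maximal too, and two elements of {0, 1} have a midpoint in
    {0, 1} only when they are equal. *)
Lemma maximal_uniq p q : generic_pairs -> maximal p -> maximal q ->
  {ae mu, forall x, forall i, p i x = q i x}.
Proof.
move=> gen pmax qmax.
have pq : gain p = gain q.
  by apply/le_anti; rewrite qmax.2 ?pmax.2//; [case: qmax|case: pmax].
have mmax : maximal (midpoint p q).
  split; first by apply: feasible_midpoint; [case: pmax|case: qmax].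
  move=> r fr; rewrite gain_midpoint; [|by case: pmax => -[]|by case: qmax => -[]].
  have := pmax.2 r fr; rewrite -pq; lra.
apply: filterS3 (maximal_idem gen pmax) (maximal_idem gen qmax)
  (maximal_idem gen mmax) => x pi qi mi i.
have := mi i; rewrite /midpoint => m2.
(* (p - q)^2 = 2 p^2 + 2 q^2 - 4 m^2 = 2 p + 2 q - 4 m = 0 *)
have : (p i x - q i x) ^+ 2 = 0.
  have -> : (p i x - q i x) ^+ 2 = 2 * (p i x * p i x) + 2 * (q i x * q i x)
    - 4 * (2^-1 * (p i x + q i x) * (2^-1 * (p i x + q i x))) by field.
  by rewrite m2 pi qi; field.
by move/eqP; rewrite expf_eq0/= subr_eq0 => /eqP.
Qed.

Definition energy p := E (fun x => \sum_i p i x * p i x).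

Definition distance p q :=
  E (fun x => \sum_i (p i x - q i x) * (p i x - q i x)).

Lemma energy_le1 p : fractional_partition p -> energy p <= 1.
Proof.
move=> pp; rewrite -(mean_cst mu 1); apply: mean_le => //.
- apply: bounded_measurable_sum => i.
  by apply: bounded_measurableM; exact: fractional_partition_bm.
- exact: bounded_measurable_cst.
- move=> x; have [_ p0 p1] := pp; rewrite -(p1 x); apply: ler_sum => i _.
  by rewrite ler_piMl// fractional_partition_le1.
Qed.

Lemma energy_ge0 p : 0 <= energy p.
Proof.
by apply: Rintegral_ge0 => x _; apply: sumr_ge0 => i _; rewrite -expr2 sqr_ge0.
Qed.

Lemma parallelogram p q : fractional_partition p -> fractional_partition q ->
  distance p q = 2 * energy p + 2 * energy q - 4 * energy (midpoint p q).
Proof.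
move=> pp qq; have mm := fractional_partition_midpoint pp qq.
have bm2 r : fractional_partition r ->
    bounded_measurable (fun x => \sum_i r i x * r i x).
  move=> rr; apply: bounded_measurable_sum => i.
  by apply: bounded_measurableM; exact: fractional_partition_bm.
rewrite -!meanZ -?meanD -?meanB; try by repeat first
  [ apply: bounded_measurableD | apply: bounded_measurableZ | exact: bm2].
congr (E _); apply/funext => x; rewrite !mulr_sumr -big_split -sumrB/=.
by apply: eq_bigr => i _; rewrite /midpoint; field.
Qed.

End constrained.

End fractional_partitions.

(** * Almost everywhere convergence *)

Section ae_convergence.
Context d (T : measurableType d) (R : realType) (mu : probability T R).

Local Notation E := (Rintegral mu setT).

Definition halves n : R := 1 / (2 ^ n.+1)%:R.

Lemma halves_gt0 n : 0 < halves n.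
Proof. by rewrite /halves divr_gt0// ltr0n expn_gt0. Qed.

Lemma is_cvg_series_halves : cvgn (series halves).
Proof.
have := @cvg_geometric_series_half R 1 0; rewrite (_ : (fun _ => _) = halves).
  exact: cvgP.
by apply/funext => n; rewrite addn1.
Qed.

Lemma halves_nonincreasing n : halves n.+1 <= halves n.
Proof.
rewrite /halves !div1r lef_pV2 ?posrE ?ltr0n ?expn_gt0// ler_nat.
by rewrite leq_exp2l.
Qed.

Lemma cvg_summable_increments (u c : nat -> R) :
  cvgn (series c) -> (forall n, `|u n.+1 - u n| <= c n) -> cvgn u.
Proof.
move=> cc uc.
have -> : u = (fun n => u 0%N + series (telescope u) n).
  by apply/funext => n; exact: eq_sum_telescope.
apply: is_cvgD; first exact: is_cvg_cst.
apply: normed_cvg; apply: series_le_cvg cc => n.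
- exact: normr_ge0.
- by rewrite (le_trans _ (uc n)).
- exact: uc.
Qed.

(** Monotone convergence: the sum of the series has a finite integral. *)
Lemma ae_summable (b : nat -> T -> R) :
  (forall n, bounded_measurable (b n)) -> (forall n x, 0 <= b n x) ->
  (forall n, E (b n) <= halves n) ->
  {ae mu, forall x, cvgn (series (b ^~ x))}.
Proof.
move=> bb b0 Eb.
have mb n : measurable_fun setT (EFin \o b n).
  by apply/measurable_EFinP; case: (bb n).
have bint : mu.-integrable setT (fun x => \sum_(n <oo) (b n x)%:E)%E.
  apply/integrableP; split.
    by apply: ge0_emeasurable_sum => n *; [rewrite lee_fin|exact: mb].
  have -> : (fun x => `|\sum_(n <oo) (b n x)%:E|)%E =
      (fun x => \sum_(n <oo) (b n x)%:E)%E.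
    by apply/funext => x; rewrite gee0_abs// nneseries_ge0// => n _ _;
      rewrite lee_fin.
  rewrite integral_nneseries//; last by move=> n x _; rewrite lee_fin.
  apply: (@le_lt_trans _ _ (\sum_(n <oo) (halves n)%:E)%E).
    apply: lee_nneseries => [n _ _|n _].
      by apply: integral_ge0 => x _; rewrite lee_fin.
    by rewrite mean_EFin// lee_fin.
  by apply: le_lt_trans (epsilon_trick0 _ ler01) _; rewrite ltry.
apply: filterS (integrable_ae measurableT bint) => x /(_ I) bfin.
apply: nondecreasing_is_cvgn; first by apply: nondecreasing_series => n _ _; exact: b0.
exists (fine (\sum_(n <oo) (b n x)%:E)) => _ [n _ <-].
rewrite -lee_fin fineK// seriesEnat/= -sumEFin.
by apply: nneseries_lim_ge => k _ _; rewrite lee_fin.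
Qed.

Lemma cvg_mean (u : nat -> T -> R) (v : T -> R) (M : R) :
  (forall n, measurable_fun setT (u n)) -> measurable_fun setT v ->
  (forall n x, `|u n x| <= M) ->
  {ae mu, forall x, u ^~ x @ \oo --> v x} ->
  E (u n) @[n --> \oo] --> E v.
Proof.
move=> mu_ mv uM uv.
have := @dominated_convergence _ _ _ mu setT measurableT
  (fun n => EFin \o u n) (EFin \o v) (cst M%:E).
case.
- by move=> n; apply/measurable_EFinP.
- exact/measurable_EFinP.
- apply: filterS uv => x uvx _; apply: cvg_EFin => //; exact: nearW.
- by have := bounded_measurable_integrable mu (bounded_measurable_cst T M).
- by apply: aeW => x n _; rewrite lee_fin.
- move=> iv _ cv; apply: fine_cvg; rewrite fineK; last first.
    exact: integrable_fin_num.
  exact: cv.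
Qed.

End ae_convergence.

(** * Existence of a maximal fractional partition *)

Section existence.
Context d (T : measurableType d) (R : realType) (mu : probability T R).
Context (I : finType) (psi phi : I -> T -> R).
Hypothesis psi_bm : forall i, bounded_measurable (psi i).
Hypothesis phi_bm : forall i, bounded_measurable (phi i).
Variable C : (I -> R) -> Prop.
Hypothesis C_midpoint : forall a b, C a -> C b ->
  C (fun i => 2^-1 * (a i + b i)).
Hypothesis C_closed : forall (a : nat -> I -> R) (b : I -> R),
  (forall n, C (a n)) -> (forall i, a ^~ i @ \oo --> b i) -> C b.
Implicit Types p q : I -> T -> R.

Local Notation E := (Rintegral mu setT).
Local Notation feasible := (feasible mu psi C).
Local Notation gain := (gain mu phi).

Lemma gain_bounded : exists M, forall p, fractional_partition p -> gain p <= M.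
Proof.
have /choice[M phiM] : forall i, exists M : R, forall x, `|phi i x| <= M.
  by move=> i; case: (phi_bm i).
exists (\sum_i M i) => p pp; apply: ler_sum => i _.
rewrite -(mean_cst mu (M i)); apply: mean_le.
- by apply: bounded_measurableM => //; exact: fractional_partition_bm.
- exact: bounded_measurable_cst.
- move=> x; apply: le_trans (ler_norm _) _; rewrite normrM.
  have [_ p0 _] := pp; rewrite (ger0_norm (p0 _ _)).
  by apply: le_trans (phiM i x); rewrite ler_piMr// fractional_partition_le1.
Qed.

(** Let V be the supremum of the gain, and D the limit, as V' increases to V,
    of the infimum of the energy over the partitions of gain above V'; in the
    proof D is the supremum of the set A of eventual lower bounds of the
    energy. Partitions of gain near V and energy near D have midpoints of
    energy at least about D, so the parallelogram identity makes them close. *)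
Lemma maximizing_sequence p0 : feasible p0 ->
  exists P : nat -> I -> T -> R, [/\ forall n, feasible (P n),
    forall n q, feasible q -> gain q <= gain (P n) + halves R n &
    forall n, distance mu (P n) (P n.+1) <= halves R n ^+ 2].
Proof.
move=> fp0.
pose G := [set gain p | p in feasible].
have hsG : has_sup G.
  split; first by exists (gain p0), p0.
  by have [M hM] := gain_bounded; exists M => _ [p [pp _] <-]; exact: hM.
have gain_le q : feasible q -> gain q <= sup G.
  by move=> fq; apply: ub_le_sup; [case: hsG|exists q].
have near_sup e : 0 < e -> exists2 p, feasible p & sup G - e < gain p.
  by move=> e0; have [_ [p fp <-] ep] := sup_adherent e0 hsG; exists p.
pose A := [set a : R | exists2 e, 0 < e &
  forall q, feasible q -> sup G - e < gain q -> a <= energy mu q].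
have hsA : has_sup A.
  split; first by exists 0, 1 => // q _ _; exact: energy_ge0.
  exists 1 => a [e e0 ha]; have [q fq qe] := near_sup e e0.
  by apply: le_trans (ha q fq qe) _; apply: energy_le1; case: fq.
have stage n : exists p, [/\ feasible p, sup G - halves R n < gain p,
    energy mu p < sup A + halves R n ^+ 2 / 8 &
    forall q, feasible q -> gain p <= gain q ->
      sup A - halves R n ^+ 2 / 8 < energy mu q].
  have e0 : 0 < halves R n ^+ 2 / 8 by rewrite divr_gt0// exprn_gt0// halves_gt0.
  have [a [e' e'0 ha] sa] := sup_adherent e0 hsA.
  pose m := Num.min e' (halves R n).
  have m0 : 0 < m by rewrite lt_min e'0 halves_gt0.
  (* otherwise sup A + halves n ^ 2 / 8 would be an eventual lower bound *)
  have [p [fp mp Ep]] : exists p, [/\ feasible p, sup G - m < gain p &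
      energy mu p < sup A + halves R n ^+ 2 / 8].
    apply: contrapT => noq.
    suff : sup A + halves R n ^+ 2 / 8 <= sup A by rewrite gerDl leNgt e0.
    apply: ub_le_sup; first by case: hsA.
    exists m => // q fq mq; rewrite leNgt; apply/negP => Eq.
    by apply: noq; exists q.
  have mp1 : sup G - e' < gain p.
    by apply: le_lt_trans mp; rewrite lerB// /m ge_min lexx.
  exists p; split=> //.
    by apply: le_lt_trans mp; rewrite lerB// /m ge_min lexx orbT.
  move=> q fq pq; apply: lt_le_trans sa _; apply: ha => //.
  exact: lt_le_trans pq.
have [P hP] := choice stage; exists P; split.
- by move=> n; case: (hP n).
- move=> n q fq; have [_ + _ _] := hP n; have := gain_le q fq; lra.
- move=> n.
  have [fP _ EP lowP] := hP n; have [fP' _ EP' lowP'] := hP n.+1.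
  have [pP _] := fP; have [pP' _] := fP'.
  have fm := feasible_midpoint psi_bm C_midpoint fP fP'.
  have gm := gain_midpoint mu phi_bm pP pP'.
  have h2 : halves R n.+1 ^+ 2 <= halves R n ^+ 2.
    by rewrite lerXn2r ?nnegrE ?(ltW (halves_gt0 _ _))// halves_nonincreasing.
  rewrite parallelogram//.
  (* the midpoint gains at least as much as the worse of its two ends, so the
     energy bound attached to that end applies to it *)
  have Em : sup A - halves R n ^+ 2 / 8 < energy mu (midpoint (P n) (P n.+1)).
    have [le|/ltW le] := lerP (gain (P n)) (gain (P n.+1)).
      by apply: lowP => //; rewrite gm; lra.
    apply: le_lt_trans (lowP' _ fm _); first by lra.
    by rewrite gm; lra.
  lra.
Qed.

(** Along a fast L^2-Cauchy sequence, |a| <= h + a^2 / h bounds the increments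
    by the terms of an almost everywhere convergent series. *)
Lemma fast_Cauchy_ae_cvg (P : nat -> I -> T -> R) :
  (forall n, fractional_partition (P n)) ->
  (forall n, distance mu (P n) (P n.+1) <= halves R n ^+ 2) ->
  {ae mu, forall x, forall i, cvgn (fun n => P n i x)}.
Proof.
move=> pP dP; have h0 := halves_gt0 R.
pose D n x := \sum_i (P n i x - P n.+1 i x) * (P n i x - P n.+1 i x).
pose b n x := (halves R n)^-1 * D n x.
have bD n : bounded_measurable (D n).
  apply: bounded_measurable_sum => i.
  by apply: bounded_measurableM; apply: bounded_measurableB;
    exact: fractional_partition_bm.
have D0 n x : 0 <= D n x.
  by apply: sumr_ge0 => i _; rewrite -expr2 sqr_ge0.
have bb n : bounded_measurable (b n) by exact: bounded_measurableZ.
have b0 n x : 0 <= b n x by rewrite mulr_ge0 ?D0// invr_ge0 ltW.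
have Eb n : E (b n) <= halves R n.
  rewrite meanZ// ler_pdivrMl// -expr2; exact: dP.
apply: filterS (ae_summable bb b0 Eb) => x bx i.
apply: (@cvg_summable_increments _ _ (fun n => halves R n + b n x)).
  by apply: is_cvg_seriesD => //; exact: is_cvg_series_halves.
move=> n; rewrite distrC.
set a := P n i x - P n.+1 i x.
have aD : a * a <= D n x.
  rewrite /D (bigD1 i)//= lerDl.
  by apply: sumr_ge0 => j _; rewrite -expr2 sqr_ge0.
have [ah|/ltW ah] := lerP `|a| (halves R n); first by rewrite ler_wpDr.
rewrite ler_wpDl ?(ltW (h0 n))// ler_pdivlMl//.
apply: le_trans aD; have -> : a * a = `|a| * `|a|.
  by rewrite -normrM ger0_norm// -expr2 sqr_ge0.
by rewrite ler_wpM2r.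
Qed.

Lemma fractional_partition_limit (P : nat -> I -> T -> R) :
  (forall n, fractional_partition (P n)) ->
  {ae mu, forall x, forall i, cvgn (fun n => P n i x)} ->
  exists2 p, fractional_partition p &
    {ae mu, forall x, forall i, P n i x @[n --> \oo] --> p i x}.
Proof.
move=> pP [N [mN N0 cvN]].
(* off a null set the sequence converges; on it, it is frozen at P 0 *)
pose P' n i x := if x \in N then P 0%N i x else P n i x.
have P'cvg i x : P' n i x @[n --> \oo] --> lim (P' n i x @[n --> \oo]).
  rewrite /P'; case: (boolP (x \in N)) => xN; first exact: is_cvg_cst.
  suff /(_ i) : forall i, cvgn (fun n => P n i x) by [].
  by apply: contrapT => ncv; move/negP: xN; apply; rewrite inE; exact: cvN.
have pP' n : fractional_partition (P' n).
  have [m0 ge00 s0] := pP 0%N; have [mn gen0 sn] := pP n; split.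
  - move=> i; apply: measurable_fun_if => //; try exact: measurable_funTS.
    by apply: (measurable_fun_bool true); rewrite setTI preimage_mem_true.
  - by move=> i x; rewrite /P'; case: ifP.
  - by move=> x; rewrite /P'; case: (x \in N).
exists (fun i x => lim (P' n i x @[n --> \oo])); last first.
  exists N; split=> // x /= nc; apply: contrapT => xN; apply: nc => i.
  by have := P'cvg i x; rewrite /P' memNset.
split.
- move=> i; apply: (measurable_fun_cvg (h := fun n => P' n i)) => // n.
  by have [] := pP' n.
- move=> i x; apply: limr_ge; first exact: P'cvg.
  by apply: nearW => n; have [] := pP' n.
- move=> x; have cs : \sum_i P' n i x @[n --> \oo] -->
      \sum_i lim (P' n i x @[n --> \oo]).
    by apply: cvg_big => [|i _]; [exact: add_continuous|exact: P'cvg].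
  apply: (cvg_unique _ cs) => //.
  by apply: cvg_near_cst; apply: nearW => n; have [_ _] := pP' n.
Qed.

Lemma cvg_mean_fractional (u : T -> R) (P : nat -> I -> T -> R) p i :
  bounded_measurable u -> (forall n, fractional_partition (P n)) ->
  fractional_partition p ->
  {ae mu, forall x, forall i, P n i x @[n --> \oo] --> p i x} ->
  E (fun x => u x * P n i x) @[n --> \oo] --> E (fun x => u x * p i x).
Proof.
move=> [mu_ [M uM]] pP pp Pp; apply: (@cvg_mean _ _ _ _ _ _ M).
- by move=> n; apply: measurable_funM => //; have [] := pP n.
- by apply: measurable_funM => //; have [] := pp.
- move=> n x; rewrite normrM; have [_ P0 _] := pP n.
  rewrite (ger0_norm (P0 _ _)); apply: le_trans (uM x).
  by rewrite ler_piMr// fractional_partition_le1.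
- by apply: filterS Pp => x Px; exact: cvgMl_tmp.
Qed.

Lemma exists_maximal p0 : feasible p0 -> exists p, maximal mu psi phi C p.
Proof.
move=> /maximizing_sequence[P [fP gP dP]].
have pP n : fractional_partition (P n) by case: (fP n).
have [p pp Pp] := fractional_partition_limit pP (fast_Cauchy_ae_cvg pP dP).
exists p; split.
  split=> //; apply: (@C_closed (fun n => moment mu psi (P n))).
    by move=> n; case: (fP n).
  by move=> i; exact: cvg_mean_fractional.
move=> q fq.
have gcvg : gain (P n) + halves R n @[n --> \oo] --> gain p + 0.
  apply: cvgD; first by apply: cvg_big => [|i _];
    [exact: add_continuous|exact: cvg_mean_fractional].
  exact/cvg_series_cvg_0/is_cvg_series_halves.
rewrite -[gain p]addr0; apply: (cvgr_to_ge gcvg).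
by apply: nearW => n; exact: gP.
Qed.

End existence.

(** * Subpartitions and densities *)

Section densities.
Context d (T : measurableType d) (R : realType) (mu : probability T R).
Implicit Types nu : {measure set T -> \bar R}.

Local Notation E := (Rintegral mu setT).

Definition has_density nu (f : T -> R) := forall A, measurable A ->
  nu A = (\int[mu]_(x in A) (f x)%:E)%E.

(** The restriction of nu to the whole space is the same measure packaged as
    a finite one, as the Radon-Nikodym theorem requires. *)
Lemma has_density_exists nu : (forall A, measurable A -> (nu A <= mu A)%E) ->
  exists f : T -> R, [/\ measurable_fun setT f, forall x, 0 <= f x & has_density nu f].
Proof.
move=> numu.
have nufin : (nu setT < +oo)%E.
  by apply: le_lt_trans (numu _ measurableT) _; exact: fin_num_fun_lty (fin_num_measure mu).
have dom : mfrestr measurableT nufin `<< mu.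
  apply/null_content_dominatesP => A mA mA0.
  rewrite /mfrestr /mrestr setIT; apply/le_anti.
  by rewrite measure_ge0 andbT -mA0 numu.
have [f [f0 ffin fint nuf]] := radon_nikodym_sigma_finite dom.
exists (fine \o f); split.
- by apply: measurableT_comp => //; exact: measurable_int fint.
- by move=> x; exact: fine_ge0.
- move=> A mA; transitivity (mfrestr measurableT nufin A).
    by rewrite /mfrestr /mrestr setIT.
  by rewrite [LHS]nuf//; apply: eq_integral => x _; rewrite /= fineK.
Qed.

(** Change of variables, for any bounded density rather than the chosen
    Radon-Nikodym derivative; the two agree a.e. *)
Lemma integral_has_density nu f u : bounded_measurable f ->
  has_density nu f -> bounded_measurable u ->
  (\int[nu]_x (u x)%:E = (E (fun x => u x * f x))%:E)%E.
Proof.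
move=> bf nuf bu.
have ifT := bounded_measurable_integrable mu bf.
have nufin : (nu setT < +oo)%E.
  rewrite nuf//; have := integrable_fin_num measurableT ifT.
  by rewrite fin_numElt => /andP[].
have nu_restr A : measurable A -> mfrestr measurableT nufin A = nu A.
  by move=> mA; rewrite /mfrestr /mrestr setIT.
have dom : mfrestr measurableT nufin `<< mu.
  apply/null_content_dominatesP => A mA mA0; rewrite nu_restr// nuf//.
  by rewrite null_set_integral//; apply/measurable_EFinP/measurable_funTS; case: bf.
rewrite (eq_measure_integral (mfrestr measurableT nufin)); last first.
  by move=> A mA _; apply/esym/nu_restr.
rewrite -(Radon_Nikodym_change_of_variables dom)//; last first.
  case: bu => mu_ [M uM].
  apply: measurable_bounded_integrable => //.
    exact: fin_num_fun_lty (fin_num_measure _).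
  by exists M; split; [exact: num_real|move=> L ML x _; exact: le_trans (ltW ML)].
rewrite -mean_EFin; last exact: bounded_measurableM.
have mu_ : measurable_fun setT (EFin \o u) by apply/measurable_EFinP; case: bu.
apply: ae_eq_integral => //.
- exact: emeasurable_funM.
- by apply/measurable_EFinP; case: (bounded_measurableM bu bf).
- under [X in ae_eq _ _ _ X]eq_fun do rewrite EFinM.
  apply: ae_eqe_mul2l; apply: ae_eq_sym; apply: integral_ae_eq => //.
  move=> A _ mA; rewrite -Radon_Nikodym_integral//=.
  by rewrite nu_restr// nuf.
Qed.

Context {N : nat}.

Lemma sum_option (V : nmodType) (F : option 'I_N -> V) :
  \sum_a F a = F None + \sum_i F (Some i).
Proof.
rewrite (bigD1 None)//= (reindex_omap Some id); last by case.
by congr (_ + _); apply: eq_bigl => i; rewrite eqxx.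
Qed.

(** The component None of p is the density of the part of mu that the
    subpartition leaves unassigned. *)
Definition has_densities (nu : 'I_N -> {measure set T -> \bar R})
    (p : option 'I_N -> T -> R) :=
  fractional_partition p /\ forall i, has_density (nu i) (p (Some i)).

(** The bound on the measures gives densities of sum at most 1 a.e.; they are
    modified on a null set so that it holds everywhere. *)
Lemma has_densities_exists (nu : 'I_N -> {measure set T -> \bar R}) :
  (forall A, measurable A -> (\sum_(i < N) nu i A <= mu A)%E) ->
  exists p, has_densities nu p.
Proof.
move=> numu.
have /choice[g /all_and3[mg g0 nug]] : forall i, exists f : T -> R,
    [/\ measurable_fun setT f, forall x, 0 <= f x & has_density (nu i) f].
  move=> i; apply: has_density_exists => A mA; apply: le_trans (numu A mA).
  by rewrite (bigD1 i)//= leeDl// sume_ge0.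
pose s x := \sum_i g i x.
have ms : measurable_fun setT s by exact: measurable_sum.
have s0 x : 0 <= s x by exact: sumr_ge0.
have nus A : measurable A -> (\sum_(i < N) nu i A = \int[mu]_(x in A) (s x)%:E)%E.
  move=> mA; under [RHS]eq_integral do rewrite /s -sumEFin.
  rewrite ge0_integral_sum//.
  - by apply: eq_bigr => i _; exact: nug.
  - by move=> i; apply/measurable_EFinP; exact: measurable_funTS.
  - by move=> i x _; rewrite lee_fin.
pose B := [set x | 1 < s x].
have mB : measurable B.
  rewrite -[B]setTI (_ : B = s @^-1` `]1, +oo[%classic).
    exact: ms.
  by apply/seteqP; split=> x /=; rewrite in_itv/= andbT.
have sint : mu.-integrable setT (EFin \o s).
  apply/integrableP; split; first exact/measurable_EFinP.
  under eq_integral do rewrite /= ger0_norm//.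
  rewrite -nus//; apply: le_lt_trans (numu _ measurableT) _.
  exact: fin_num_fun_lty (fin_num_measure mu).
(* on B both s > 1 and, by the bound on the measures, s = 1 a.e. *)
have s1 : {ae mu, forall x, s x <= 1}.
  have : ae_eq mu B (EFin \o s) (cst 1%E).
    apply: integral_ae_eq => //; first exact: integrableS sint.
    move=> A AB mA; apply/le_anti/andP; split.
      by rewrite -nus// integral_cst// mul1e numu.
    apply: ge0_le_integral => //.
    - exact/measurable_EFinP/measurable_funTS.
    - by move=> x /AB /ltW; rewrite lee_fin.
  apply: filterS => x sB; rewrite leNgt; apply/negP => s1.
  by have [] := sB s1 => s1'; move: s1; rewrite s1' ltxx.
(* the densities are cut off where their sum exceeds 1, on a null set *)
pose f i x := if s x <= 1 then g i x else 0.
have mf i : measurable_fun setT (f i).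
  apply: measurable_fun_ifT => //.
  exact: measurable_fun_ler.
have f0 i x : 0 <= f i x by rewrite /f; case: ifP.
have fs x : \sum_i f i x <= 1.
  have [sx|sx] := boolP (s x <= 1); last first.
    by rewrite big1// => i _; rewrite /f (negbTE sx).
  by apply: le_trans sx; apply: ler_sum => i _; rewrite /f; case: ifP.
exists (fun a => if a is Some i then f i else fun x => 1 - \sum_i f i x).
split; first split.
- case=> [i//|]; apply: measurable_funB => //; exact: measurable_sum.
- by case=> [i//|] x; rewrite subr_ge0.
- by move=> x; rewrite sum_option subrK.
move=> i A mA; rewrite nug//; apply: ae_eq_integral => //;
  try exact/measurable_EFinP/measurable_funTS.
by apply: filterS s1 => x sx _; rewrite /f sx.
Qed.

Lemma has_densities_le (nu : 'I_N -> {measure set T -> \bar R}) p : has_densities nu p ->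
  forall A, measurable A -> (\sum_(i < N) nu i A <= mu A)%E.
Proof.
move=> [[mp p0 p1] nup] A mA.
have -> : (\sum_(i < N) nu i A =
    \int[mu]_(x in A) \sum_(i < N) (p (Some i) x)%:E)%E.
  rewrite ge0_integral_sum//.
  - by apply: eq_bigr => i _; exact: nup.
  - by move=> i; apply/measurable_EFinP; exact: measurable_funTS.
  - by move=> i x _; rewrite lee_fin.
rewrite -[leRHS]mul1e -integral_cst//; apply: ge0_le_integral => //.
- by move=> x _; apply: sume_ge0 => i _; rewrite lee_fin.
- by apply: emeasurable_sum => i; apply/measurable_EFinP; exact: measurable_funTS.
- by move=> x _; rewrite sumEFin lee_fin -(p1 x) sum_option lerDr.
Qed.

End densities.

(** * Indicator densities, continuous functions and moment constraints *)

Section indicator_densities.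
Context d (T : measurableType d) (R : realType) (mu : probability T R).

Local Notation E := (Rintegral mu setT).

(** An a.e. idempotent function is a.e. the indicator of {f = 1}. *)
Lemma integral_idempotent (f u : T -> R) (A : set T) :
  measurable_fun setT f -> {ae mu, forall x, f x * f x = f x} ->
  measurable_fun setT u -> measurable A ->
  (\int[mu]_(x in A `&` f @^-1` [set 1%R]) (u x)%:E =
   \int[mu]_(x in A) (u x * f x)%:E)%E.
Proof.
move=> mf ff mu_ mA.
have mY : measurable (f @^-1` [set 1]) by rewrite -[X in measurable X]setTI; exact: mf.
rewrite integral_mkcondr; apply: ae_eq_integral => //.
- apply/measurable_restrict => //.
  by apply/measurable_EFinP; exact: measurable_funTS.
- by apply/measurable_EFinP/measurable_funTS; exact: measurable_funM.
- apply: filterS ff => x fx _; rewrite patchE.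
  have [fx1|fx1] := eqVneq (f x) 1; first by rewrite mem_set// fx1 mulr1.
  rewrite memNset; last by move/eqP: fx1.
  have /eqP : f x * (f x - 1) = 0 by rewrite mulrBr fx mulr1 subrr.
  by rewrite mulf_eq0 [_ - 1 == 0]subr_eq0 (negbTE fx1) orbF => /eqP->; rewrite mulr0.
Qed.

Lemma has_density_mrestr (f : T -> R) (mY : measurable (f @^-1` [set 1])) :
  measurable_fun setT f -> {ae mu, forall x, f x * f x = f x} ->
  has_density mu (mrestr mu mY) f.
Proof.
move=> mf ff A mA; under eq_integral do rewrite -[f _]mul1r.
rewrite -(@integral_idempotent f (fun=> 1))// integral_cst ?mul1e//.
exact: measurableI.
Qed.

End indicator_densities.

Section continuous_profiles.
Context {R : realType} {X : ptopologicalType}.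

Lemma continuous_bounded_measurable (f : X -> R) : compact [set: X] ->
  continuous f -> @bounded_measurable _ (borel X) R f.
Proof.
move=> cX cf; split.
  apply: (measurability _ (RGenOpens.measurableE R)) => _ [_ [a [b ->] <-]].
  rewrite setTI; apply: sub_sigma_algebra.
  by move/continuousP : cf; apply; exact: interval_open.
have : compact (f @` [set: X]).
  by apply: continuous_compact => //; exact: continuous_subspaceT.
move=> /compact_bounded[M [_ fM]]; exists (M + 1) => x.
by apply: fM; [rewrite ltrDl|exists x].
Qed.

Context {N : nat}.
Variables psi phi : 'I_N -> X -> R.

(** The unassigned part carries no moment and no profit. *)
Definition extend0 (u : 'I_N -> X -> R) (a : option 'I_N) : borel X -> R :=
  if a is Some i then u i else fun=> 0.

Lemma extend0_bounded_measurable (u : 'I_N -> X -> R) : compact [set: X] ->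
  (forall i, continuous (u i)) -> forall a, bounded_measurable (extend0 u a).
Proof.
move=> cX cu [i|]; first exact: (continuous_bounded_measurable cX (cu i)).
exact: bounded_measurable_cst.
Qed.

(** Condition (A) is genericity of pairs of genuine indices, condition (B) of
    the pairs that contain the unassigned part. *)
Lemma extend0_generic_pairs (mu : probability (borel X) R) :
  (forall i j, i != j -> forall alpha beta : R,
     mu [set x | alpha * psi i x - beta * psi j x + phi i x - phi j x = 0] = 0%E) ->
  (forall i (alpha : R), mu [set x | phi i x = alpha * psi i x] = 0%E) ->
  generic_pairs mu (extend0 psi) (extend0 phi).
Proof.
move=> hA hB [i|] [j|] // ij a b /=.
- exact: hA.
- rewrite -(hB i (- a)); congr (mu _); apply/seteqP.
  by split=> x /=; lra.
- rewrite -(hB j (- b)); congr (mu _); apply/seteqP.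
  by split=> x /=; lra.
Qed.

Variables (mu : probability (borel X) R) (K : set 'rV[R]_N).
Hypothesis psi_bm : forall a, bounded_measurable (extend0 psi a).
Hypothesis phi_bm : forall a, bounded_measurable (extend0 phi a).

Definition admissible_moments (c : option 'I_N -> R) : Prop :=
  K (\row_i c (Some i)).

Lemma profit_has_densities nu p : has_densities mu nu p ->
  profit phi nu = (gain mu (extend0 phi) p)%:E.
Proof.
move=> [pp nup]; rewrite /gain sum_option.
have -> : Rintegral mu setT (fun x => extend0 phi None x * p None x) = 0.
  rewrite -[RHS](mean_cst mu 0); congr (Rintegral _ _ _).
  by apply/funext => x; rewrite mul0r.
rewrite add0r -sumEFin; apply: eq_bigr => i _.
rewrite (integral_has_density _ (nup i))//; first exact: fractional_partition_bm.
exact: (phi_bm (Some i)).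
Qed.

Lemma moment_has_densities nu p : has_densities mu nu p ->
  forall i, (\int[nu i]_x (psi i x)%:E =
    (moment mu (extend0 psi) p (Some i))%:E)%E.
Proof.
move=> [pp nup] i.
rewrite (integral_has_density _ (nup i))//; first exact: fractional_partition_bm.
exact: (psi_bm (Some i)).
Qed.

Lemma weak_subpartitions_has_densities nu p : has_densities mu nu p ->
  weak_subpartitions mu psi
    (\row_i moment mu (extend0 psi) p (Some i)) nu.
Proof.
move=> dp; split; first exact: has_densities_le dp.
by move=> i; rewrite mxE; exact: moment_has_densities.
Qed.

Lemma weak_subpartitions_feasible nu : weak_subpartitions_in mu psi K nu ->
  exists2 p, has_densities mu nu p &
    feasible mu (extend0 psi) admissible_moments p.
Proof.
move=> [m Km [numu num]]; have [p dp] := has_densities_exists numu.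
exists p => //; split; first by case: dp.
rewrite /admissible_moments (_ : \row_i _ = m)//; apply/rowP => i; rewrite mxE.
by apply: EFin_inj; rewrite -num; exact/esym/moment_has_densities.
Qed.

Lemma admissible_moments_midpoint : @convex_set R 'rV[R]_N K ->
  forall a b, admissible_moments a -> admissible_moments b ->
  admissible_moments (fun i => 2^-1 * (a i + b i)).
Proof.
move=> cK a b Ka Kb.
have half_ge0 : 0 <= 2^-1 :> R by rewrite invr_ge0.
have half_le1 : 2^-1 <= 1 :> R by rewrite invf_le1// ler1n.
have := cK _ _ (Itv01 half_ge0 half_le1) (mem_set Ka) (mem_set Kb).
rewrite inE /admissible_moments; congr K; apply/rowP => i.
rewrite /conv/= !mxE /unstable.onem; lra.
Qed.

Lemma admissible_moments_closed : closed K ->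
  forall (a : nat -> option 'I_N -> R) (b : option 'I_N -> R),
  (forall n, admissible_moments (a n)) ->
  (forall i, a ^~ i @ \oo --> b i) -> admissible_moments b.
Proof.
move=> cK a b Ka ab.
apply: (@closed_cvg _ _ \oo _ (fun n => \row_i a n (Some i)) K cK).
  by apply: nearW => n; exact: Ka.
move=> A [P bP PA].
have near_entry i j : \forall n \near \oo, P i j ((\row_i a n (Some i)) i j).
  have bPij : nbhs (b (Some j)) (P i j) by have := bP i j; rewrite mxE.
  have aPij : \forall n \near \oo, P i j (a n (Some j)) := ab (Some j) _ bPij.
  by apply: filterS aPij => n; rewrite mxE.
have near_row i : \forall n \near \oo, forall j, P i j ((\row_i a n (Some i)) i j).
  exact: filter_forall (near_entry i).
change (\forall n \near \oo, A (\row_i a n (Some i))).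
have near_all : \forall n \near \oo,
    forall i j, P i j ((\row_i a n (Some i)) i j) by exact: filter_forall.
by apply: filterS near_all => n; exact: PA.
Qed.

End continuous_profiles.

Theorem theorem4p2 (R : realType) (X : ptopologicalType)
  (X_compact : compact [set: X]) (X_polish : polish R X)
  (mu : probability (borel X) R) (mu_non_atomic : non_atomic mu)
  (N : nat) (psi phi : 'I_N -> X -> R)
  (psi_cont : forall i, continuous (psi i))
  (phi_cont : forall i, continuous (phi i))
  (hA : forall i j, i != j -> forall alpha beta : R,
     mu [set x | alpha * psi i x - beta * psi j x + phi i x - phi j x = 0] = 0%E)
  (hB : forall i (alpha : R), mu [set x | phi i x = alpha * psi i x] = 0%E)
  (hC_pos : forall i x, 0 < psi i x)
  (hC : forall i j, i != j -> forall alpha beta : R,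
     0 < alpha ^+ 2 + beta ^+ 2 ->
     mu [set x | alpha * psi i x + beta * psi j x = 0] = 0%E)
  (K : set 'rV[R]_N) (K_closed : closed K)
  (K_convex : @convex_set R 'rV[R]_N K)
  (K_feasible : weak_subpartitions_in mu psi K !=set0) :
  exists nu : 'I_N -> {measure set (borel X) -> \bar R},
    [/\ maximizes_profit mu psi phi K nu,
        forall nu', maximizes_profit mu psi phi K nu' -> eq_subpartition nu' nu &
        exists2 m, K m & strong_subpartitions mu psi m nu].
Proof.
have psi_bm := extend0_bounded_measurable X_compact psi_cont.
have phi_bm := extend0_bounded_measurable X_compact phi_cont.
have gen := extend0_generic_pairs hA hB.
have Kmid := admissible_moments_midpoint K_convex.
have Kcl := admissible_moments_closed K_closed.
have [nu0 /(weak_subpartitions_feasible psi_bm)[p0 _ fp0]] := K_feasible.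
have [p pmax] := exists_maximal psi_bm phi_bm Kmid Kcl fp0.
have [[pp Kp] pbest] := pmax.
have [mp p_ge0 p1] := pp.
have pidem i : {ae mu, forall x, p (Some i) x * p (Some i) x = p (Some i) x}.
  by apply: filterS (maximal_idem psi_bm phi_bm gen pmax) => x.
pose Y i : set (borel X) := p (Some i) @^-1` [set 1].
have mY i : measurable (Y i) by rewrite -[Y i]setTI; exact: mp.
pose nu i : {measure set (borel X) -> \bar R} := mrestr mu (mY i).
have dp : has_densities mu nu p.
  by split=> // i; exact: has_density_mrestr.
have nuK : weak_subpartitions_in mu psi K nu.
  by exists (\row_i moment mu (extend0 psi) p (Some i)) => //;
    exact: weak_subpartitions_has_densities.
exists nu; split.
- split=> // nu' /(weak_subpartitions_feasible psi_bm)[p' dp' fp'].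
  rewrite (profit_has_densities phi_bm dp) (profit_has_densities phi_bm dp').
  by rewrite lee_fin; exact: pbest.
- move=> nu' [/(weak_subpartitions_feasible psi_bm)[p' dp' fp'] nu'best] i A mA.
  have p'max : maximal mu (extend0 psi) (extend0 phi) (admissible_moments K) p'.
    split=> // q fq; apply: le_trans (pbest q fq) _; have := nu'best nu nuK.
    by rewrite (profit_has_densities phi_bm dp) (profit_has_densities phi_bm dp')
      lee_fin.
  have [[mp' _ _] nu'p'] := dp'.
  rewrite nu'p'// (dp.2 i)//; apply: ae_eq_integral => //;
    try by apply/measurable_EFinP; exact: measurable_funTS.
  apply: filterS (maximal_uniq psi_bm phi_bm Kmid gen p'max pmax) => x -> //.
- exists (\row_i moment mu (extend0 psi) p (Some i)) => //; split.
    exact: weak_subpartitions_has_densities.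
  exists Y; split=> //.
  + move=> i j ij; rewrite (_ : Y i `&` Y j = set0) ?measure0//.
    apply/seteqP; split=> x //= [pi pj]; have := p1 x.
    rewrite (bigD1 (Some i))//= (bigD1 (Some j))/=; last first.
      by apply: contra_neq ij => -[].
    rewrite pi pj; set s := \sum_(_ | _) _.
    have : 0 <= s by apply: sumr_ge0.
    lra.
  + move=> i; rewrite mxE -mean_EFin; last first.
      by apply: bounded_measurableM => //; exact: fractional_partition_bm.
    rewrite -[Y i]setTI (integral_idempotent (mp (Some i)))//.
    by case: (psi_bm (Some i)).
Qed.
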